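(* Let $A\in\mathbb{R}^{n\times n}$ be symmetric with $\sigma(A)\subset[a,b]$, let $f:[a,b]\to\mathbb{R}$ be continuous, let $d\ge1$ be an integer, and let $C_1,\dots,C_m$ be a distance-$d$ coloring of $\mathcal{G}(A)$. Suppose that $[f(A)]_{ij}$ has constant sign for all $i,j$ with $\mathrm{d}(i,j)>d$ (i.e. either $[f(A)]_{ij}\ge0$ for all such $i,j$, or $[f(A)]_{ij}\le0$ for all such $i,j$). Let $$\mathcal{T}_d(f(A))=\sum_{\ell=1}^m\boldsymbol{v}_\ell^Tf(A)\boldsymbol{v}_\ell,\qquad \boldsymbol{v}_\ell=\sum_{i\in C_\ell}\boldsymbol{e}_i,$$ be the deterministic probing approximation of $\operatorname{tr}(f(A))$, and let $$\mathcal{T}_d^{\mathbb{1}}(f(A))=\sum_{\ell=1}^m\boldsymbol{w}_\ell^Tf(A)\boldsymbol{w}_\ell,\qquad \boldsymbol{w}_\ell=\sum_{i\in C_\ell}X_i\boldsymbol{e}_i,\quad X_i\in\{-1,1\},$$ be the stochastic probing approximation using just one Rademacher probing vector $\boldsymbol{w}_\ell$ for each color. Then (for every realization of the Rademacher vectors) $$|\mathcal{T}_d^{\mathbb{1}}(f(A))-\operatorname{tr}(f(A))|\le|\mathcal{T}_d(f(A))-\operatorname{tr}(f(A))|.$$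
   Context: $\sigma(A)$ is the spectrum of $A$. For symmetric $A$, $f(A)$ is the matrix function defined through the spectral decomposition. $[M]_{ij}$ is the $(i,j)$ entry of $M$, $\boldsymbol{e}_i$ is the $i$th canonical basis vector of $\mathbb{R}^n$. $\mathcal{G}(A)=(V,E)$ is the undirected graph with $V=\{1,\dots,n\}$ and $E=\{(i,j): i\ne j,\ [A]_{ij}\ne 0\}$; $\mathrm{d}(i,j)$ is the geodesic (shortest path) distance in $\mathcal{G}(A)$ ($\infty$ if there is no path). A distance-$d$ coloring with $m$ colors is a partition of $V$ of the form $C_\ell=\{i:\operatorname{col}(i)=\ell\}$, $\ell=1,\dots,m$, for a map $\operatorname{col}:V\to\{1,\dots,m\}$ satisfying $\operatorname{col}(i)\ne\operatorname{col}(j)$ whenever $i\ne j$ and $\mathrm{d}(i,j)\le d$. A Rademacher probing vector has $X_i$ i.i.d. taking the values $\pm1$ with probability $\tfrac12$ each. *)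

(* Defs.v *)
From HB Require Import structures.
From mathcomp Require Import all_boot all_order all_algebra.
From mathcomp Require Import all_classical all_reals all_analysis.
From mathcomp Require complex.
From mathcomp Require Import ring.

Set Implicit Arguments.
Unset Strict Implicit.
Unset Printing Implicit Defensive.

Import Order.TTheory GRing.Theory Num.Theory.
Local Open Scope classical_set_scope.
Local Open Scope ring_scope.

(* For a symmetric real matrix every complex eigenvalue is real and left and
   right eigenvalues agree, so this is the whole spectrum. *)
Definition spectrum (R : realType) (n : nat) (A : 'M[R]_n) : set R :=
  [set x | eigenvalue A x].

(* A = Q diag(lam) Q^T with Q orthogonal. *)
Definition spectral_decomposition (R : realType) (n : nat) (A : 'M[R]_n)
    (Ql : 'M[R]_n * 'rV[R]_n) : Prop :=
  Ql.1^T *m Ql.1 = 1%:M /\ A = Ql.1 *m diag_mx Ql.2 *m Ql.1^T.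

(* f(A) = Q diag(f lam) Q^T for a chosen spectral decomposition of A. The
   default value of choose is irrelevant when A is symmetric
   (spectral_decomposition_exists), and so is the choice (matfunE). *)
Definition matfun (R : realType) (n : nat) (f : R -> R) (A : 'M[R]_n) : 'M[R]_n :=
  let Ql := xget (1%:M, 0) [set Ql | spectral_decomposition A Ql] in
  Ql.1 *m diag_mx (map_mx f Ql.2) *m Ql.1^T.

Definition adjacent (R : realType) (n : nat) (A : 'M[R]_n) : rel 'I_n :=
  [rel i j | (i != j) && (A i j != 0)].

(* The infimum of the empty set is +oo, the distance between vertices in
   different components. *)
Definition geodist (R : realType) (n : nat) (A : 'M[R]_n) (i j : 'I_n) : \bar R :=
  ereal_inf [set ((size p)%:R)%:E | p in
    [set p : seq 'I_n | path (adjacent A) i p /\ last i p = j]].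

Definition distance_coloring (R : realType) (n m : nat) (A : 'M[R]_n) (d : nat)
    (col : 'I_n -> 'I_m) : Prop :=
  forall i j : 'I_n, i != j -> (geodist A i j <= (d%:R)%:E)%E -> col i != col j.

Definition color_class (n m : nat) (col : 'I_n -> 'I_m) (l : 'I_m) : {set 'I_n} :=
  [set i | col i == l]%SET.

Definition quadform (R : realType) (n : nat) (M : 'M[R]_n) (v : 'cV[R]_n) : R :=
  (v^T *m M *m v) 0 0.

Definition probing_vec (R : realType) (n m : nat) (col : 'I_n -> 'I_m)
    (l : 'I_m) : 'cV[R]_n :=
  \sum_(i in color_class col l) delta_mx i 0.

Definition probing (R : realType) (n m : nat) (col : 'I_n -> 'I_m)
    (M : 'M[R]_n) : R :=
  \sum_(l < m) quadform M (probing_vec R col l).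

(* X is a realization of the Rademacher vector. *)
Definition sign_probing_vec (R : realType) (n m : nat) (col : 'I_n -> 'I_m)
    (X : 'I_n -> R) (l : 'I_m) : 'cV[R]_n :=
  \sum_(i in color_class col l) X i *: delta_mx i 0.

Definition stochastic_probing (R : realType) (n m : nat) (col : 'I_n -> 'I_m)
    (X : 'I_n -> R) (M : 'M[R]_n) : R :=
  \sum_(l < m) quadform M (sign_probing_vec col X l).

Import complex.

Lemma real_eigenvalue (R : realType) (n : nat) (A : 'M[R]_n.+1) :
  A^T = A -> exists x, eigenvalue A x.
Proof.
move=> symA; pose C : numClosedFieldType := R[i]%C.
pose B : 'M[C]_n.+1 := map_mx (real_complex R) A.
have hB : B \is hermsymmx.
  apply: realsym_hermsym.
    apply/is_hermitianmxP; rewrite expr0 scale1r.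
    by apply/matrixP => i j; rewrite !mxE /= -[in LHS]symA mxE.
  apply/mxOverP => i j; rewrite mxE; apply/complex_realP; by exists (A i j).
have /mxOverP xr := hermitian_spectral_diag_real hB.
have /orthomx_spectralP eB := hermitian_normalmx hB.
move: eB xr (spectral_unit B).
set P := spectralmx B; set X := spectral_diag B => eB xr uP.
have PB : P *m B = diag_mx X *m P by rewrite eB !mulmxA mulmxV // mul1mx.
have : eigenvalue B (X 0 0).
  apply/eigenvalueP; exists (row 0 P).
    by rewrite -row_mul PB row_mul row_diag_mx -scalemxAl -rowE.
  apply: contraTneq uP => r0.
  rewrite -row_free_unit; apply/negP => /row_freeP [Q /(congr1 (row 0))].
  rewrite row_mul r0 mul0mx => /rowP/(_ 0); rewrite !mxE eqxx => /eqP.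
  by rewrite eq_sym oner_eq0.
rewrite eigenvalue_root_char -map_char_poly /=.
have /complex_realP [x ->] := xr 0 0.
by rewrite fmorph_root -eigenvalue_root_char; exists x.
Qed.

Lemma cV_norm_gt0 (R : realType) (n : nat) (u : 'cV[R]_n) :
  u != 0 -> 0 < (u^T *m u) 0 0.
Proof.
move=> u0; have e : (u^T *m u) 0 0 = \sum_i u i 0 ^+ 2.
  by rewrite mxE; apply: eq_bigr => i _; rewrite mxE expr2.
rewrite lt0r e sumr_ge0 ?andbT; last by move=> i _; exact: sqr_ge0.
apply: contraNneq u0 => /eqP.
rewrite psumr_eq0 => [/allP h|i _]; last exact: sqr_ge0.
apply/eqP/colP => i; rewrite mxE.
by have := h i (mem_index_enum i); rewrite /= sqrf_eq0 => /eqP.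
Qed.

Lemma householder (R : realType) (n : nat) (u : 'cV[R]_n.+1) :
  u^T *m u = 1%:M ->
  exists H : 'M[R]_n.+1, H^T *m H = 1%:M /\ H *m delta_mx 0 0 = u.
Proof.
move=> u1; pose e : 'cV[R]_n.+1 := delta_mx 0 0.
have [ue|w0] := eqVneq (u - e) 0.
  exists 1%:M; rewrite trmx1 !mul1mx; split=> //.
  by apply/esym/eqP; rewrite -subr_eq0 ue.
move: w0; set w := u - e => w0.
pose c := (w^T *m w) 0 0.
have c0 : c != 0 by rewrite gt_eqF // cV_norm_gt0.
have ww : w^T *m w = c%:M by rewrite [LHS]mx11_scalar.
have e1 : e^T *m e = 1%:M.
  by rewrite trmx_delta mul_delta_mx; apply/matrixP=> i j; rewrite !ord1 !mxE.
pose a := (u^T *m e) 0 0.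
have ue : u^T *m e = a%:M by rewrite [LHS]mx11_scalar.
have eu : e^T *m u = a%:M by rewrite -[LHS]trmxK trmx_mul trmxK ue tr_scalar_mx.
have wT : w^T = u^T - e^T by rewrite /w linearB.
have we : w^T *m e = (a - 1)%:M.
  by rewrite wT mulmxBl ue e1 raddfB.
have cE : c = 2 - 2 * a.
  have : c%:M = (2 - 2 * a)%:M :> 'M[R]_1.
    rewrite -ww wT mulmxBl !mulmxBr u1 ue eu e1 -!raddfB /=.
    by congr (_%:M); ring.
  by move/matrixP/(_ 0 0); rewrite !mxE eqxx !mulr1n.
pose H : 'M[R]_n.+1 := 1%:M - (2 / c) *: (w *m w^T).
have HT : H^T = H.
  by rewrite linearB linearZ /= trmx1 trmx_mul trmxK.
exists H; split.
  have SS : w *m w^T *m (w *m w^T) = c *: (w *m w^T).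
    by rewrite mulmxA -(mulmxA w) ww mul_mx_scalar -scalemxAl.
  have kk : 2 / c * (2 / c) * c = 2 / c + 2 / c by field.
  rewrite HT mulmxBl !mulmxBr !mul1mx !mulmx1 -scalemxAl -scalemxAr SS.
  by rewrite !scalerA kk scalerDl opprB addrA addrA addrNK addrK.
rewrite mulmxBl mul1mx -scalemxAl -mulmxA we mul_mx_scalar scalerA.
have -> : 2 / c * (a - 1) = -1.
  by move: c0; rewrite cE => c0; field.
by rewrite scaleN1r opprK addrC subrK.
Qed.

Lemma spectral_decomposition_exists (R : realType) (n : nat) (A : 'M[R]_n) :
  A^T = A -> exists Ql, spectral_decomposition A Ql.
Proof.
elim: n A => [|n IHn] A symA.
  exists (1%:M, 0).
  by split; apply/matrixP => -[].
have [x /eigenvalueP [v vA v0]] := real_eigenvalue symA.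
pose s := (v *m v^T) 0 0.
have s0 : 0 < s by have := @cV_norm_gt0 _ _ v^T; rewrite trmxK; apply; rewrite trmx_eq0.
have vv : v *m v^T = s%:M by rewrite [LHS]mx11_scalar.
pose u : 'cV[R]_n.+1 := (Num.sqrt s)^-1 *: v^T.
have u1 : u^T *m u = 1%:M.
  have -> : u^T = (Num.sqrt s)^-1 *: v by rewrite /u linearZ /= trmxK.
  rewrite -scalemxAl -scalemxAr scalerA vv.
  rewrite -mul_scalar_mx -scalar_mxM -expr2 exprVn sqr_sqrtr ?ltW //.
  by rewrite mulVf // gt_eqF.
have Au : A *m u = x *: u.
  rewrite /u -scalemxAr -[in LHS]symA -trmx_mul vA linearZ /=.
  by rewrite !scalerA mulrC.
have [H [HTH He]] := householder u1.
have HHT : H *m H^T = 1%:M by apply: mulmx1C.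
pose B : 'M[R]_(1 + n) := H^T *m A *m H.
have BT : B^T = B by rewrite !trmx_mul trmxK symA mulmxA.
have Be : B *m delta_mx 0 0 = x *: delta_mx 0 0 :> 'cV[R]_(1 + n).
  by rewrite -mulmxA He -mulmxA Au -scalemxAr -He mulmxA HTH mul1mx.
have AE : A = H *m B *m H^T.
  by rewrite /B !mulmxA HHT mul1mx -mulmxA HHT mulmx1.
move: BT Be AE; move: B => B BT Be AE.
have Bi0 i : B i 0 = x *+ (i == 0).
  move/colP/(_ i): Be; rewrite -colE !mxE eqxx andbT => ->.
  by rewrite mulr_natr.
have B0i i : B 0 i = x *+ (i == 0) by rewrite -BT mxE Bi0.
have l0 : lshift n 0 = 0 :> 'I_(1 + n) by apply/val_inj.
have BE : B = block_mx x%:M 0 0 (drsubmx B).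
  rewrite -[LHS]submxK; congr block_mx; apply/matrixP => i j.
  - by rewrite !mxE !ord1 l0 Bi0.
  - by rewrite !mxE !ord1 l0 B0i.
  - by rewrite !mxE !ord1 l0 Bi0.
have [|[Q l] [/= QTQ dQ]] := IHn (drsubmx B).
  by rewrite -[in RHS]BT trmx_drsub.
pose Q1 : 'M[R]_(1 + n) := block_mx 1%:M 0 0 Q.
have Q1T : Q1^T = block_mx 1%:M 0 0 Q^T by rewrite tr_block_mx trmx1 !trmx0.
have QTQ1 : Q1^T *m Q1 = 1%:M.
  rewrite Q1T /Q1 (mulmx_block (1%:M : 'M[R]_1)).
  rewrite !(mul0mx, mulmx0, mul1mx, addr0, add0r) QTQ.
  by rewrite -scalar_mx_block.
exists (H *m Q1, row_mx x%:M l); split=> /=.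
  rewrite trmx_mul mulmxA -(mulmxA _ H^T) HTH mulmx1.
  exact: QTQ1.
have dE : diag_mx (row_mx x%:M l) = block_mx x%:M 0 0 (diag_mx l) :> 'M[R]_(1 + n).
  rewrite diag_mx_row; congr block_mx.
  by apply/matrixP => i j; rewrite !ord1 !mxE.
rewrite AE trmx_mul !mulmxA; congr (_ *m _); rewrite -!mulmxA; congr (_ *m _).
have QdQ : Q1 *m diag_mx (row_mx x%:M l) *m Q1^T = B.
  rewrite Q1T dE /Q1 !mulmx_block.
  by rewrite !(mul0mx, mulmx0, mul1mx, mulmx1, addr0, add0r) -dQ -BE.
by rewrite -QdQ !mulmxA.
Qed.

Lemma matfunE (R : realType) (n : nat) (f : R -> R) (A : 'M[R]_n)
    (Q : 'M[R]_n) (l : 'rV[R]_n) :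
  Q^T *m Q = 1%:M -> A = Q *m diag_mx l *m Q^T ->
  matfun f A = Q *m diag_mx (map_mx f l) *m Q^T.
Proof.
move=> QTQ AE; rewrite /matfun.
case: xgetP => [[P m] _ [/= PTP PE]|/(_ (Q, l))]; last by case.
have PPT : P *m P^T = 1%:M by apply: mulmx1C.
have QQT : Q *m Q^T = 1%:M by apply: mulmx1C.
pose W := P^T *m Q.
have W1 : diag_mx m *m W = W *m diag_mx l.
  have : P^T *m A *m Q = P^T *m A *m Q by [].
  rewrite {1}PE AE !mulmxA PTP mul1mx => ->.
  by rewrite -(mulmxA _ Q^T) QTQ mulmx1 /W.
have QE : Q = P *m W by rewrite mulmxA PPT mul1mx.
have WWT : W *m W^T = 1%:M.
  by rewrite trmx_mul trmxK !mulmxA -(mulmxA _ Q) QQT mulmx1 PTP.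
move: W W1 QE WWT => W W1 QE WWT.
have Wf : diag_mx (map_mx f m) *m W = W *m diag_mx (map_mx f l).
  apply/matrixP => i j; move/matrixP/(_ i j): W1.
  rewrite !mul_diag_mx !mul_mx_diag !mxE => e.
  have [->|w0] := eqVneq (W i j) 0; first by rewrite mulr0 mul0r.
  rewrite mulrC; congr (_ * f _); apply: (mulIf w0); by rewrite e mulrC.
rewrite [in RHS]QE -(mulmxA P W) -Wf.
rewrite trmx_mul.
by rewrite !mulmxA -(mulmxA _ W) WWT mulmx1.
Qed.

(* Main.v *)
(* An error of either probing approximation only comes from the off-diagonal
   pairs of equal color, because X_i^2 = 1. Such pairs are at distance larger
   than d, so for deterministic probing all terms have the same sign and no
   cancellation occurs, while random signs can only create cancellation. *)
Require Import Defs.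
From mathcomp Require Import all_boot all_order all_algebra.
From mathcomp Require Import all_classical all_reals all_analysis.
Import Order.TTheory GRing.Theory Num.Theory.
Import numFieldNormedType.Exports.
Local Open Scope classical_set_scope.
Local Open Scope ring_scope.

Lemma quadformE (R : realType) (n : nat) (M : 'M[R]_n) (v : 'cV[R]_n) :
  quadform M v = \sum_i \sum_j v i 0 * v j 0 * M i j.
Proof.
rewrite /quadform -mulmxA mxE; apply: eq_bigr => i _.
rewrite !mxE mulr_sumr; apply: eq_bigr => j _.
by rewrite mulrA mulrAC.
Qed.

Lemma sign_probing_vecE (R : realType) (n m : nat) (col : 'I_n -> 'I_m)
    (X : 'I_n -> R) (l : 'I_m) (i : 'I_n) :
  sign_probing_vec col X l i 0 = X i *+ (col i == l).
Proof.
rewrite summxE.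
under eq_bigr => k _ do rewrite !mxE eqxx andbT.
have [il|il] := boolP (col i == l).
  rewrite (bigD1 i) /= ?inE // eqxx mulr1 big1 ?addr0 // => k /andP[_].
  by rewrite eq_sym => /negPf ->; rewrite mulr0.
rewrite big1 // => k; rewrite inE => kl.
by case: (eqVneq i k) => [ik|_]; [rewrite ik kl in il | rewrite mulr0].
Qed.

(** Treats deterministic probing as the realization with all signs $+1$, so that one error formula
    serves both approximations. *)
Lemma probing_stochastic (R : realType) (n m : nat) (col : 'I_n -> 'I_m)
    (M : 'M[R]_n) :
  probing col M = stochastic_probing col (fun=> 1) M.
Proof.
apply: eq_bigr => l _; congr quadform; apply: eq_bigr => i _.
by rewrite scale1r.
Qed.

Lemma stochastic_probing_error (R : realType) (n m : nat)
    (col : 'I_n -> 'I_m) (X : 'I_n -> R) (M : 'M[R]_n) :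
  (forall i, X i * X i = 1) ->
  stochastic_probing col X M - \tr M =
  \sum_(p : 'I_n * 'I_n | (p.1 != p.2) && (col p.1 == col p.2))
    X p.1 * X p.2 * M p.1 p.2.
Proof.
move=> X2; apply/eqP; rewrite subr_eq addrC; apply/eqP.
have -> : stochastic_probing col X M =
    \sum_i \sum_(j | col i == col j) X i * X j * M i j.
  rewrite /stochastic_probing.
  under eq_bigr => l _ do rewrite quadformE.
  rewrite exchange_big; apply: eq_bigr => i _.
  rewrite exchange_big [RHS]big_mkcond; apply: eq_bigr => j _ /=.
  (* For a fixed pair only the color [l = col i] contributes, since entry [i] of every other probing
     vector vanishes. *)
  rewrite (bigD1 (col i)) //= !sign_probing_vecE eqxx eq_sym big1 ?addr0.
    by case: eqP => _; rewrite ?mulr1n // mulr0 mul0r.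
  move=> l /negPf li; rewrite sign_probing_vecE eq_sym li.
  by rewrite !mul0r.
(* Iterated sums on both sides let the diagonal term [j = i] be split off for each [i]; it is
   [M i i] because [X i * X i = 1]. *)
rewrite -(pair_big_dep xpredT (fun i j => (i != j) && (col i == col j))
  (fun i j => X i * X j * M i j)) /mxtrace -big_split /=.
apply: eq_bigr => i _; rewrite (bigD1 i) //= X2 mul1r.
by congr (_ + _); apply: eq_bigl => j; rewrite andbC eq_sym.
Qed.

(** Equality case of the triangle inequality. *)
Lemma norm_sum_constant_sign (R : realDomainType) (I : finType) (P : pred I)
    (F : I -> R) :
  (forall i, P i -> 0 <= F i) \/ (forall i, P i -> F i <= 0) ->
  `|\sum_(i | P i) F i| = \sum_(i | P i) `|F i|.
Proof.
case=> F0.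
  by rewrite ger0_norm ?sumr_ge0 //; apply: eq_bigr => i /F0/ger0_norm.
rewrite ler0_norm ?sumr_le0 // -sumrN.
by apply: eq_bigr => i /F0/ler0_norm.
Qed.

Theorem proposition3p15 (R : realType) (n : nat) (A : 'M[R]_n) (a b : R)
    (f : R -> R) (d m : nat) (col : 'I_n -> 'I_m) :
  A^T = A ->
  spectrum A `<=` `[a, b] ->
  {within `[a, b], continuous f} ->
  (1 <= d)%N ->
  distance_coloring A d col ->
  (forall i j : 'I_n, ((d%:R)%:E < geodist A i j)%E -> 0 <= matfun f A i j) \/
  (forall i j : 'I_n, ((d%:R)%:E < geodist A i j)%E -> matfun f A i j <= 0) ->
  forall X : 'I_n -> R,
  (forall i : 'I_n, X i = -1 \/ X i = 1) ->
  `|stochastic_probing col X (matfun f A) - \tr (matfun f A)|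
    <= `|probing col (matfun f A) - \tr (matfun f A)|.
Proof.
move=> _ _ _ _ colA signM X X1; move: (matfun f A) signM => M signM.
have far (p : 'I_n * 'I_n) : (p.1 != p.2) && (col p.1 == col p.2) ->
    ((d%:R)%:E < geodist A p.1 p.2)%E.
  case/andP=> p12 cp; rewrite ltNge; apply/negP => /(colA _ _ p12).
  by rewrite cp.
have X2 i : X i * X i = 1.
  by case: (X1 i) => ->; rewrite ?mulrNN mulr1.
have nX i : `|X i| = 1.
  by case: (X1 i) => ->; rewrite ?normrN normr1.
rewrite probing_stochastic !stochastic_probing_error //; last first.
  by move=> i; rewrite mulr1.
under [in leRHS]eq_bigr => p _ do rewrite !mul1r.
(* The deterministic error is exactly the sum of [|M i j|] over distinct pairs of equal color, all
   of them far apart. *)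
rewrite [leRHS]norm_sum_constant_sign; last first.
  by case: signM => s; [left => p /far/s | right => p /far/s].
(* The triangle inequality bounds the stochastic error by the same sum, the signs having absolute
   value 1. *)
apply: (le_trans (ler_norm_sum _ _ _)); apply: ler_sum => p _.
by rewrite !normrM !nX !mul1r.
Qed.
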